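(* As formal power series in $z$, $$1+\sum_{n\ge1}C_n(\mathbf{u},t,s,h\,|\,\alpha,\beta\,;\,p,q)\,z^n=\mathcal{J}(z;\mathbf{b},\boldsymbol{\lambda}),$$ where $b_0=t\alpha\beta$ and, for $k\ge1$, $$b_k=(sh)^k\Bigl(tq^ks^k+u_4[\,k;\beta,1\,]_{p,qs}+u_3\,p\,[\,k;\alpha,1\,]_{p,qs}\Bigr),$$ $$\lambda_k=u_1u_2(sh)^{2k-1}[\,k;\alpha,1\,]_{p,qs}\,[\,k;\beta,1\,]_{p,qs}.$$
   Context: For $\sigma\in\mathfrak{S}_n$ (permutations of $[n]$, with $\sigma_i=\sigma(i)$), an index $i\in[n]$ is: a fixed point if $\sigma(i)=i$; a cycle peak if $\sigma^{-1}(i)<i>\sigma(i)$; a cycle valley if $\sigma^{-1}(i)>i<\sigma(i)$; a cycle double ascent if $\sigma^{-1}(i)<i<\sigma(i)$; a cycle double descent if $\sigma^{-1}(i)>i>\sigma(i)$. Let $\mathrm{fix},\mathrm{cval},\mathrm{cda},\mathrm{cdd}$ count fixed points, cycle valleys, cycle double ascents, cycle double descents. $\mathrm{inv}(\sigma)=\#\{i<j:\sigma_i>\sigma_j\}$; $\mathrm{depth}(\sigma)=\sum_{\sigma(i)>i}(\sigma(i)-i)$; $\mathrm{lmax}(\sigma)$ is the number of letters $\sigma_i$ with $\sigma_i>\sigma_j$ for all $j<i$; $\mathrm{rmin}(\sigma)$ is the number of letters $\sigma_i$ with $\sigma_i<\sigma_j$ for all $j>i$; $$\mathrm{cros}(\sigma)=\#\{(i,j)\in[n]^2:(i<j\le\sigma_i<\sigma_j)\lor(i>j>\sigma_i>\sigma_j)\},$$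 $$\mathrm{nest}(\sigma)=\#\{(i,j)\in[n]^2:(i<j\le\sigma_j<\sigma_i)\lor(i>j>\sigma_j>\sigma_i)\}.$$ With $\mathbf{u}=(u_1,u_2,u_3,u_4)$ and indeterminates $t,s,h,\alpha,\beta,p,q$, $$C_n(\mathbf{u},t,s,h\,|\,\alpha,\beta\,;\,p,q)=\sum_{\sigma\in\mathfrak{S}_n}(u_1u_2)^{\mathrm{cval}(\sigma)}u_3^{\mathrm{cda}(\sigma)}u_4^{\mathrm{cdd}(\sigma)}t^{\mathrm{fix}(\sigma)}s^{\mathrm{inv}(\sigma)}h^{\mathrm{depth}(\sigma)}\alpha^{\mathrm{lmax}(\sigma)}\beta^{\mathrm{rmin}(\sigma)}p^{\mathrm{cros}(\sigma)}q^{\mathrm{nest}(\sigma)}.$$ For $k\ge 1$: $[\,k;a,b\,]_{p,q}=(a-1)p^{k-1}+(b-1)q^{k-1}+\frac{p^k-q^k}{p-q}$; the subscript $p,qs$ means $q$ is replaced by $qs$. For sequences $\mathbf{b}=(b_k)_{k\ge0}$, $\boldsymbol{\lambda}=(\lambda_k)_{k\ge1}$ in a commutative ring, $\mathcal{J}(z;\mathbf{b},\boldsymbol{\lambda})$ is the formal power series $$\mathcal{J}(z;\mathbf{b},\boldsymbol{\lambda})=\cfrac{1}{1-b_0z-\cfrac{\lambda_1z^2}{1-b_1z-\cfrac{\lambda_2z^2}{1-b_2z-\ddots}}}.$$ *)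

(* Defs.v *)
From HB Require Import structures.
From mathcomp Require Import all_boot all_order all_algebra all_fingroup.

Set Implicit Arguments.
Unset Strict Implicit.
Unset Printing Implicit Defensive.

Import GRing.Theory.

(* Permutations of [n] are elements of 'S_n, so indices and letters run over
   0, ..., n-1 instead of 1, ..., n; every statistic below depends only on
   comparisons and differences, hence is unchanged by this shift. *)

Section PermutationStatistics.
Local Open Scope nat_scope.
Variables (n : nat) (s : 'S_n).

Definition is_cval (i : 'I_n) : bool := (i < (s^-1)%g i) && (i < s i).
Definition is_cda (i : 'I_n) : bool := (s^-1)%g i < i < s i.
Definition is_cdd (i : 'I_n) : bool := s i < i < (s^-1)%g i.

Definition cval : nat := #|[set i | is_cval i]|.
Definition cda : nat := #|[set i | is_cda i]|.
Definition cdd : nat := #|[set i | is_cdd i]|.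
Definition fixp : nat := #|[set i | s i == i]|.

Definition invs : nat := #|[set ij : 'I_n * 'I_n |
  (ij.1 < ij.2) && (s ij.2 < s ij.1)]|.

Definition depth : nat := \sum_(i < n | i < s i) (s i - i).

Definition lmax : nat :=
  #|[set i : 'I_n | [forall j : 'I_n, (j < i) ==> (s j < s i)]]|.
Definition rmin : nat :=
  #|[set i : 'I_n | [forall j : 'I_n, (i < j) ==> (s i < s j)]]|.

Definition cros : nat := #|[set ij : 'I_n * 'I_n | let: (i, j) := ij in
  [&& i < j, j <= s i & s i < s j] || [&& s j < s i, s i < j & j < i]]|.

Definition nest : nat := #|[set ij : 'I_n * 'I_n | let: (i, j) := ij in
  [&& i < j, j <= s j & s j < s i] || [&& s i < s j, s j < j & j < i]]|.

End PermutationStatistics.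

Local Open Scope ring_scope.

Definition Cpoly (R : comNzRingType) (n : nat)
    (u1 u2 u3 u4 t s h alpha beta p q : R) : R :=
  \sum_(sg : 'S_n)
    (u1 * u2) ^+ cval sg * u3 ^+ cda sg * u4 ^+ cdd sg * t ^+ fixp sg
    * s ^+ invs sg * h ^+ depth sg * alpha ^+ lmax sg * beta ^+ rmin sg
    * p ^+ cros sg * q ^+ nest sg.

(* The polynomial (p^k - q^k) / (p - q), written so as to make sense in any
   commutative ring: see pqintP and pqintE. *)
Definition pqint (R : comNzRingType) (p q : R) (k : nat) : R :=
  \sum_(i < k) p ^+ (k.-1 - i) * q ^+ i.

Lemma pqintP (R : comNzRingType) (p q : R) (k : nat) :
  (p - q) * pqint p q k = p ^+ k - q ^+ k.
Proof. by rewrite subrXX. Qed.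

Lemma pqintE (F : fieldType) (p q : F) (k : nat) :
  p != q -> pqint p q k = (p ^+ k - q ^+ k) / (p - q).
Proof. by rewrite -subr_eq0 => pq; rewrite -pqintP mulrC mulKf. Qed.

(* [k; a, b]_{p,q}, meaningful for k >= 1. *)
Definition pqbracket (R : comNzRingType) (k : nat) (a b p q : R) : R :=
  (a - 1) * p ^+ k.-1 + (b - 1) * q ^+ k.-1 + pqint p q k.

(* Formal power series, given by their sequences of coefficients; two series
   are equal when all their coefficients are, i.e. when they are related
   by =1. *)
Definition fps (R : comNzRingType) : Type := nat -> R.

Section PowerSeries.
Variable R : comNzRingType.
Implicit Types (f g : fps R) (b l : nat -> R).

Definition fps_one : fps R := fun n => (n == 0%N)%:R.

Definition fps_mul f g : fps R := fun n => \sum_(i < n.+1) f i * g (n - i)%N.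

(* The coefficients 0, ..., n of 1 / f, for f with constant coefficient 1. *)
Fixpoint fps_inv_seq f (n : nat) : seq R :=
  if n is m.+1 then
    let r := fps_inv_seq f m in
    rcons r (- \sum_(i < m.+1) f i.+1 * r`_(m - i))
  else [:: 1].

Definition fps_inv f : fps R := fun n => (fps_inv_seq f n)`_n.

(* The series 1 - b0 z - l1 z^2 F(z). *)
Definition jden (b0 l1 : R) (F : fps R) : fps R :=
  fun n => match n with 0 => 1 | 1 => - b0 | m.+2 => - (l1 * F m) end.

(* The convergent with m levels,
   1 / (1 - b_0 z - l_1 z^2 / ( ... - l_(m-1) z^2 / (1 - b_(m-1) z))).
   The sequence l is used from index 1 on; l 0 is irrelevant. *)
Fixpoint jconv (m : nat) b l : fps R :=
  if m is m'.+1 then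
    fps_inv (jden (b 0%N) (l 1%N)
      (jconv m' (fun k => b k.+1) (fun k => l k.+1)))
  else fun=> 0.

(* The limit of the convergents in the z-adic topology: the coefficient of
   z^n is the same in all convergents with m > n / 2 levels (jconv_stable). *)
Definition Jfrac b l : fps R := fun n => jconv n.+1 b l n.

Lemma size_fps_inv_seq f n : size (fps_inv_seq f n) = n.+1.
Proof. by elim: n => //= n IHn; rewrite size_rcons IHn. Qed.

Lemma nth_fps_inv_seq f n i : (i <= n)%N -> (fps_inv_seq f n)`_i = fps_inv f i.
Proof.
elim: n => [|n IHn]; first by rewrite leqn0 => /eqP->.
rewrite leq_eqVlt => /predU1P[-> //|lt_in].
by rewrite /= nth_rcons size_fps_inv_seq lt_in IHn.
Qed.

Lemma fps_inv0 f : fps_inv f 0%N = 1.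
Proof. by []. Qed.

Lemma fps_invS f n :
  fps_inv f n.+1 = - \sum_(i < n.+1) f i.+1 * fps_inv f (n - i)%N.
Proof.
rewrite {1}/fps_inv /= nth_rcons size_fps_inv_seq ltnn eqxx; congr (- _).
by apply: eq_bigr => i _; rewrite nth_fps_inv_seq // leq_subr.
Qed.

Lemma fps_mulV f : f 0%N = 1 -> fps_mul f (fps_inv f) =1 fps_one.
Proof.
move=> f0 [|n]; first by rewrite /fps_mul big_ord1 f0 mul1r.
rewrite /fps_mul big_ord_recl f0 mul1r subn0 fps_invS.
by under [X in _ + X]eq_bigr do rewrite subSS; rewrite addNr.
Qed.

Lemma eq_fps_inv f g n :
  (forall i, (i <= n)%N -> f i = g i) -> fps_inv f n = fps_inv g n.
Proof.
elim/ltn_ind: n => -[//|n] IHn eq_fg; rewrite !fps_invS; congr (- _).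
apply: eq_bigr => i _; rewrite eq_fg ?ltn_ord // IHn // => [|j le_j].
  by rewrite ltnS leq_subr.
by rewrite eq_fg // (leq_trans le_j) // (leq_trans (leq_subr _ _)).
Qed.

Lemma jconv_eq m m' b l n : (n < m.*2)%N -> (n < m'.*2)%N ->
  jconv m b l n = jconv m' b l n.
Proof.
elim: m m' b l n => [|m IHm] [|m'] b l n //= ltm ltm'.
apply: eq_fps_inv => -[|[|i]] le_in //=; congr (- (_ * _)); apply: IHm.
  by rewrite -2!ltnS (leq_ltn_trans le_in).
by rewrite -2!ltnS (leq_ltn_trans le_in).
Qed.

Lemma jconv_stable m b l n : (n < m.*2)%N -> jconv m b l n = Jfrac b l n.
Proof. by move=> ltnm; apply: jconv_eq; rewrite // -addnn leq_addl. Qed.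

Lemma JfracE b l :
  Jfrac b l =1 fps_inv (jden (b 0%N) (l 1%N)
                 (Jfrac (fun k => b k.+1) (fun k => l k.+1))).
Proof.
move=> n; apply: eq_fps_inv => -[|[|i]] //= /ltnW le_in; congr (- (_ * _)).
by apply: jconv_stable; rewrite (leq_trans le_in) // -addnn leq_addl.
Qed.

Lemma Jfrac_mul b l :
  fps_mul (jden (b 0%N) (l 1%N) (Jfrac (fun k => b k.+1) (fun k => l k.+1)))
          (Jfrac b l) =1 fps_one.
Proof.
set D := jden _ _ _ => n; rewrite -(@fps_mulV D erefl n).
by apply: eq_bigr => i _; rewrite JfracE.
Qed.

End PowerSeries.

Section Coefficients.
Variables (R : comNzRingType) (u1 u2 u3 u4 t s h alpha beta p q : R).

Definition Cgf : fps R := fun n =>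
  if n is 0 then 1 else Cpoly n u1 u2 u3 u4 t s h alpha beta p q.

Definition bcoef (k : nat) : R :=
  if k is 0 then t * alpha * beta
  else (s * h) ^+ k * (t * q ^+ k * s ^+ k
         + u4 * pqbracket k beta 1 p (q * s)
         + u3 * p * pqbracket k alpha 1 p (q * s)).

Definition lcoef (k : nat) : R :=
  u1 * u2 * (s * h) ^+ (2 * k - 1)
    * pqbracket k alpha 1 p (q * s) * pqbracket k beta 1 p (q * s).

End Coefficients.

(* Main.v *)
Require Import Defs.
From mathcomp Require Import all_boot all_order all_algebra all_fingroup.
From mathcomp Require Import ring zify.

Set Implicit Arguments.
Unset Strict Implicit.
Unset Printing Implicit Defensive.

Import GRing.Theory.
Local Open Scope ring_scope.

(** The idea is to read a permutation [x] of [0, ..., n-1] one index at a time.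
Just before index [i] is read, some positions below [i] still await a value
and equally many values below [i] still await a position.  Reading [i] is one
of five moves: [i] is a fixed point; or position [i] and value [i] both stay
open (a cycle valley); or an open position receives the value [i] and position
[i] stays open (a cycle double ascent); or position [i] receives an open value
and value [i] stays open (a cycle double descent); or both position [i] and
value [i] are matched with open partners (a cycle peak).  The number [k] of open
positions thus follows a Motzkin path.

Every statistic is a sum over [i] of a contribution determined by the move.
For [depth] it is [k].  When an open position preceded by [r] of the [k] open
positions receives a value, it creates [r] nestings and [k - 1 - r] crossings,
one more crossing for a double ascent, and a left-to-right maximum exactly when
[r = 0]; open values behave in the same way, with right-to-left minima.  A fixed
point is nested under [k] arcs, and is a record of both kinds when [k = 0].
Finally [inv = depth + nest] ([inv_depth_nest]), so [s] accompanies both [h] and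
[q].  Summing over [r] yields the brackets [pqbracket] ([closing_sumE]).

To turn this into a recursion, the part of the permutation that has already
been matched is deleted.  What remains after some moves is again a permutation,
in which the open positions and the open values are both [0, ..., k-1] and no
open position carries an open value ([unmatched_below]).  A valley leaves this
permutation as it is and raises [k]; the other moves delete one or two points
of its graph, which is the inverse of [lift_perm], and deletion changes none of
the contributions of the later indices ([statistics_lift]).  Summing over the
moves gives a three-term recursion ([open_sumS]), and such a recursion is
solved by the J-fraction ([Jfrac_path]). *)

(** * J-fractions and three-term recursions *)

Section JFraction.
Variable R : comNzRingType.
Implicit Types (f g : fps R) (b l c d : nat -> R).

Definition fps_shift f : fps R := fun n => if n is m.+1 then f m else 0.

(** Truncating to polynomials transfers the ring laws of [{poly R}] to the
product of power series. *)
Lemma coef_mul_trunc f g N n : (n < N)%N ->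
  fps_mul f g n = ((\poly_(i < N) f i) * (\poly_(i < N) g i))`_n.
Proof.
move=> ltnN; rewrite coefM; apply: eq_bigr => i _.
by rewrite !coef_poly !ifT //; have := ltn_ord i; lia.
Qed.

Lemma fps_mulC f g : fps_mul f g =1 fps_mul g f.
Proof. by move=> n; rewrite !(@coef_mul_trunc _ _ n.+1) // mulrC. Qed.

Lemma eq_fps_mul f f' g g' n : (forall i, (i <= n)%N -> f i = f' i) ->
  (forall i, (i <= n)%N -> g i = g' i) -> fps_mul f g n = fps_mul f' g' n.
Proof.
move=> ef eg; apply: eq_bigr => i _.
by rewrite ef ?eg //; have := ltn_ord i; lia.
Qed.

Lemma fps_mulA f g e : fps_mul f (fps_mul g e) =1 fps_mul (fps_mul f g) e.
Proof.
move=> n; pose tr (x : fps R) := \poly_(i < n.+1) x i.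
have trM x y i : (i <= n)%N -> fps_mul x y i = (tr x * tr y)`_i.
  by move=> le_in; apply: coef_mul_trunc.
transitivity ((tr f * (tr g * tr e))`_n).
  rewrite coefM; apply: eq_bigr => i _; have := ltn_ord i => lti.
  by rewrite coef_poly lti trM // leq_subr.
rewrite mulrA coefM; apply: eq_bigr => i _; have := ltn_ord i => lti.
by rewrite trM // coef_poly ifT //; lia.
Qed.

Lemma fps_mul_shift f g : fps_mul f (fps_shift g) =1 fps_shift (fps_mul f g).
Proof.
move=> [|n]; first by rewrite /fps_mul big_ord1 mulr0.
rewrite /fps_mul big_ord_recr /= subnn mulr0 addr0.
by apply: eq_bigr => i _; rewrite subSn // -ltnS.
Qed.

Definition stail b : nat -> R := fun k => b k.+1.

Lemma iter_stail k b i : iter k stail b i = b (i + k)%N.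
Proof. by elim: k i => [|k IHk] i /=; rewrite ?addn0 // /stail IHk addSnnS. Qed.

Lemma Jfrac0 b l : Jfrac b l 0%N = 1.
Proof. by rewrite JfracE. Qed.

Lemma JfracS b l n :
  Jfrac b l n.+1 = b 0%N * Jfrac b l n
    + l 1%N * fps_shift (fps_mul (Jfrac (stail b) (stail l)) (Jfrac b l)) n.
Proof.
rewrite JfracE fps_invS big_ord_recl /= subn0 -JfracE mulNr opprD opprK.
congr (_ + _); case: n => [|n]; first by rewrite big_ord0 oppr0 mulr0.
rewrite /= /fps_mul -sumrN mulr_sumr; apply: eq_bigr => i _ /=.
by rewrite subSS -JfracE mulNr opprK mulrA.
Qed.

(** The defining equation [J = 1 + z b_0 J + z^2 l_1 J' J] multiplied by [f]. *)
Lemma fps_mul_JfracS f b l n :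
  fps_mul f (Jfrac b l) n.+1 = f n.+1 + b 0%N * fps_mul f (Jfrac b l) n
    + l 1%N *
      fps_shift (fps_mul (fps_mul f (Jfrac b l)) (Jfrac (stail b) (stail l))) n.
Proof.
set J := Jfrac b l; set J' := Jfrac _ _.
have -> : fps_shift (fps_mul (fps_mul f J) J') n
        = fps_mul f (fps_shift (fps_mul J' J)) n.
  rewrite fps_mul_shift; case: n => //= n.
  by rewrite -fps_mulA; apply: eq_fps_mul => // i _; apply: fps_mulC.
rewrite {1}/fps_mul big_ord_recr /= subnn [J 0%N]Jfrac0 mulr1 addrC -addrA.
congr (_ + _); rewrite /fps_mul !mulr_sumr -big_split; apply: eq_bigr => i _.
rewrite /= subSn -1?ltnS // [J _.+1]JfracS -/J -/J'; ring.
Qed.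

(** The series [d_1 ... d_k z^k J_0 ... J_k], where [J_i] is the J-fraction of
the sequences shifted by [i].  It counts the paths from height [k] down to
height 0, split at their first visits to the heights [k - 1], ..., 0: [J_i]
counts the part between the first visits to [i] and to [i - 1], whose up and
down steps pair up into weights [l], and [d_i] is the step that ends it. *)
Fixpoint path_series b l d (k : nat) : fps R :=
  if k is j.+1 then
    fps_shift (fun n => d k * fps_mul (path_series b l d j)
                                (Jfrac (iter k stail b) (iter k stail l)) n)
  else Jfrac b l.

(** Expanding the last factor [J_k] by its defining equation: the term in
[b_k] is a level step, the term in [l_(k+1)] absorbs one more factor of
[path_series] and is an up step, and the constant term 1 drops the factor and
is a down step. *)
Lemma path_seriesS b l c d k n : (forall j, l j.+1 = c j * d j.+1) ->
  path_series b l d k n.+1 =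
    b k * path_series b l d k n + c k * path_series b l d k.+1 n
    + (if k is j.+1 then d k * path_series b l d j n else 0).
Proof.
move=> lcd; case: k => [|j]; last first.
  rewrite /=; case: n => [|n].
    by rewrite /= /fps_mul big_ord1 /= Jfrac0; ring.
  have lE : stail (iter j stail l) 1%N = c j.+1 * d j.+2.
    by rewrite -[stail _]/(iter j.+1 stail l) iter_stail lcd.
  rewrite fps_mul_JfracS /= lE {1}/stail iter_stail add1n.
  set X := fps_shift _ n.
  have -> : fps_mul (fps_shift (fun m => d j.+1 * fps_mul (path_series b l d j)
     (Jfrac (iter j.+1 stail b) (iter j.+1 stail l)) m))
     (Jfrac (iter j.+2 stail b) (iter j.+2 stail l)) n = d j.+1 * X.
    rewrite fps_mulC fps_mul_shift /X; case: (n) => [|m] /=; first by rewrite mulr0.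
    rewrite fps_mulC /fps_mul mulr_sumr; apply: eq_bigr => i _.
    by rewrite mulrA.
  by ring.
rewrite /= JfracS addr0 (lcd 0%N) -mulrA; congr (_ + _ * _).
case: n => [|n] /=; first by rewrite mulr0.
by rewrite fps_mulC.
Qed.

(** The recursion determines [G], so it is enough that [path_series] satisfies
it.  Only the products [c_(k-1) d_k] matter at height 0, since every up step
is matched by a down step. *)
Lemma Jfrac_path b l c d (G : nat -> fps R) :
    (forall j, l j.+1 = c j * d j.+1) ->
    (forall k, G k 0%N = (k == 0%N)%:R) ->
    (forall k n, G k n.+1 = b k * G k n + c k * G k.+1 n
       + (if k is j.+1 then d k * G j n else 0)) ->
  G 0%N =1 Jfrac b l.
Proof.
move=> lcd G0 GS n; rewrite -[Jfrac b l]/(path_series b l d 0).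
elim: n 0%N => [|n IHn] k; first by rewrite G0; case: k => [|k] //=; rewrite Jfrac0.
rewrite GS (path_seriesS _ _ _ lcd) !IHn; case: k => //= k.
by rewrite IHn.
Qed.
End JFraction.

(** * Permutation statistics as sums of local contributions *)

Section Counting.
Local Open Scope nat_scope.

Lemma card_set_sum (T : finType) (P : pred T) :
  #|[set y | P y]| = \sum_y P y.
Proof. by rewrite -sum1dep_card big_mkcond; apply: eq_bigr => y _; case: (P y). Qed.

Lemma card_pairs_sum (T : finType) (P : T -> T -> bool) :
  #|[set ab : T * T | P ab.1 ab.2]| = \sum_a \sum_b P a b.
Proof. by rewrite card_set_sum (pair_bigA _ (fun a b => P a b : nat)). Qed.

Lemma sum_ltn_ord n m : m <= n -> \sum_(b < n) (b < m) = m.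
Proof.
move=> le_mn; rewrite (eq_bigr (fun b : 'I_n => if b < m then 1 else 0)); last first.
  by move=> b _; case: ltnP.
by rewrite -big_mkcond -(big_ord_widen _ (fun=> 1)) // sum1_card card_ord.
Qed.

End Counting.

Section LocalStatistics.
Local Open Scope nat_scope.
Variables (n : nat) (x : 'S_n).
Implicit Types i a : 'I_n.

(** The number of positions still open when index [i] is read. *)
Definition height i : nat := \sum_(b < n) ((b < i) && (i <= x b)).

(** The number of points of the graph of [x] to the north-west of [(a, x a)],
that is, the number of inversions whose second position is [a]. *)
Definition nw a : nat := \sum_(b < n) ((b < a) && (x a < x b)).

(** South-east points: the inversions whose first position is [a]. *)
Definition se a : nat := \sum_(b < n) ((a < b) && (x b < x a)).

Definition ucros a : nat := \sum_(b < n) [&& a < b, b <= x a & x a < x b].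
Definition lcros a : nat := \sum_(b < n) [&& a < b, x a < x b & x b < a].

(** Seen as an arc between [a] and [x a], a point closes at the larger of the
two.  Each nesting or crossing is charged to the arc that closes first, and each
record to its own arc, at the index where that arc closes. *)
Definition nest_at i : nat :=
  ((x^-1)%g i < i) * nw ((x^-1)%g i) + (x i == i) * nw i + (x i < i) * se i.
Definition cros_at i : nat :=
  ((x^-1)%g i < i) * ucros ((x^-1)%g i) + (x i < i) * lcros i.
Definition lmax_at i : nat :=
  ((x^-1)%g i < i) * (nw ((x^-1)%g i) == 0) + (x i == i) * (nw i == 0).
Definition rmin_at i : nat :=
  (x i < i) * (se i == 0) + (x i == i) * (nw i == 0).

Lemma sum_ltn_perm m : m <= n -> \sum_(b < n) (x b < m) = m.
Proof.
move=> le_mn; rewrite -[RHS](sum_ltn_ord le_mn) [RHS](reindex_inj (@perm_inj _ x)).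
by apply: eq_bigr.
Qed.

Lemma perm_val_inj a b : x a = x b :> nat -> a = b :> nat.
Proof. by move/val_inj/perm_inj->. Qed.

(** Among the [a] positions below [a] and among the [x a] values below [x a],
the points that are below in both respects are the same; the remaining ones
are counted by [nw a] and [se a]. *)
Lemma se_nw a : se a + a = nw a + x a.
Proof.
rewrite -[val a in LHS](@sum_ltn_ord n a) ?(ltnW (ltn_ord _)) //.
rewrite -[val (x a) in RHS](@sum_ltn_perm (x a)) ?(ltnW (ltn_ord _)) //.
rewrite /se /nw -!big_split; apply: eq_bigr => b _ /=.
have [->|] := eqVneq a b; first by rewrite !ltnn.
by rewrite -(inj_eq val_inj) /= => ne_ab; have := @perm_val_inj a b; lia.
Qed.

Lemma sum_by_value (f : 'I_n -> nat) :
  \sum_(a < n) (a < x a) * f a = \sum_i ((x^-1)%g i < i) * f ((x^-1)%g i).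
Proof.
rewrite [RHS](reindex_inj (@perm_inj _ x)); apply: eq_bigr => a _.
by rewrite permK.
Qed.

(** Double counting of the pairs [(a, i)] with [a < i <= x a]. *)
Lemma depth_height : depth x = \sum_i height i.
Proof.
rewrite /height exchange_big /= /depth big_mkcond; apply: eq_bigr => a _.
have le1 := ltn_ord (x a); have le2 := ltn_ord a.
have : \sum_(i < n) ((a < i) && (i <= x a)) + \sum_(i < n) (i < a.+1)
       = \sum_(i < n) (i < maxn a.+1 (x a).+1).
  by rewrite -big_split; apply: eq_bigr => i _ /=; lia.
rewrite sum_ltn_ord ?le2 // sum_ltn_ord ?geq_max ?le1 ?le2 //.
by move: (\sum_(i < n) _) => S; case: ifP; lia.
Qed.

Lemma nest_nw_se : nest x =
  \sum_(a < n) ((a < x a) * nw a + (x a == a) * nw a + (x a < a) * se a).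
Proof.
have -> : nest x = #|[set ab : 'I_n * 'I_n |
   [&& ab.1 < ab.2, ab.2 <= x ab.2 & x ab.2 < x ab.1]
   || [&& x ab.1 < x ab.2, x ab.2 < ab.2 & ab.2 < ab.1]]|.
  by apply: eq_card => -[a b]; rewrite !inE.
rewrite (@card_pairs_sum _ (fun a b : 'I_n => [&& a < b, b <= x b & x b < x a]
   || [&& x a < x b, x b < b & b < a])) exchange_big /=.
apply: eq_bigr => a _; rewrite /nw /se !big_distrr /= -!big_split.
apply: eq_bigr => b _ /=; rewrite -(inj_eq val_inj) /=; lia.
Qed.

Lemma nest_sum : nest x = \sum_i nest_at i.
Proof.
by rewrite nest_nw_se !big_split /= sum_by_value.
Qed.

(** Group the inversions by their first position [a].  By [se_nw] there are
[nw a + (x a - a)] of them at an excedance, [nw a] at a fixed point, and these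
are the nestings at [a] plus the part of [a] in [depth]; when [x a < a] every
inversion starting at [a] is itself a nesting. *)
Lemma inv_depth_nest : invs x = depth x + nest x.
Proof.
rewrite nest_nw_se /depth (big_mkcond (fun i : 'I_n => i < x i)) -big_split /=.
rewrite /invs (@card_pairs_sum _ (fun a b : 'I_n => (a < b) && (x b < x a))).
apply: eq_bigr => a _; rewrite -/(se a); have := se_nw a.
by rewrite -(inj_eq val_inj) /=; case: ltngtP; lia.
Qed.

Lemma cros_sum : cros x = \sum_i cros_at i.
Proof.
rewrite big_split /= -sum_by_value -big_split /=.
have -> : cros x = #|[set ab : 'I_n * 'I_n |
   [&& ab.1 < ab.2, ab.2 <= x ab.1 & x ab.1 < x ab.2]
   || [&& x ab.2 < x ab.1, x ab.1 < ab.2 & ab.2 < ab.1]]|.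
  by apply: eq_card => -[a b]; rewrite !inE.
rewrite (@card_pairs_sum _ (fun a b : 'I_n => [&& a < b, b <= x a & x a < x b]
   || [&& x b < x a, x a < b & b < a])).
rewrite big_split /= [X in _ = _ + X](eq_bigr (fun a : 'I_n =>
  \sum_(b < n) [&& x a < x b, x b < a & a < b])) => [|a _]; last first.
  by rewrite /lcros big_distrr; apply: eq_bigr => b _ /=; lia.
rewrite [X in _ = _ + X]exchange_big -big_split; apply: eq_bigr => a _ /=.
rewrite /ucros big_distrr -big_split; apply: eq_bigr => b _ /=; lia.
Qed.

(** The positions of left-to-right maxima are the zeros of [nw], and by [se_nw]
[nw a > 0] as soon as [x a < a]. *)
Lemma lmax_sum : lmax x = \sum_i lmax_at i.
Proof.
rewrite /lmax_at big_split /= -(sum_by_value (fun a => nw a == 0)) -big_split /=.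
rewrite /lmax card_set_sum.
apply: eq_bigr => a _.
have -> : [forall j : 'I_n, (j < a) ==> (x j < x a)] = (nw a == 0).
  rewrite /nw sum_nat_eq0; apply: eq_forallb => b /=.
  by have := @perm_val_inj a b; case: (ltngtP (x a) (x b)); lia.
by have := se_nw a; rewrite -(inj_eq val_inj) /=; case: ltngtP; lia.
Qed.

(** The positions of right-to-left minima are the zeros of [se], and by [se_nw]
[se a > 0] as soon as [a < x a]; at a fixed point [se] and [nw] agree. *)
Lemma rmin_sum : rmin x = \sum_i rmin_at i.
Proof.
rewrite /rmin card_set_sum; apply: eq_bigr => a _.
have -> : [forall j : 'I_n, (a < j) ==> (x a < x j)] = (se a == 0).
  rewrite /se sum_nat_eq0; apply: eq_forallb => b /=.
  by have := @perm_val_inj a b; case: (ltngtP (x a) (x b)); lia.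
by have := se_nw a; rewrite /rmin_at -(inj_eq val_inj) /=; case: ltngtP; lia.
Qed.
End LocalStatistics.

(** * Deleting a point of the graph of a permutation *)

Section Deletion.
Local Open Scope nat_scope.
Variables (n : nat) (j v : 'I_n.+1) (y : 'S_n).
Let x := lift_perm j v y.

Lemma lift_perm_inv_lift a : (x^-1)%g (lift v a) = lift j ((y^-1)%g a).
Proof. by rewrite lift_permV lift_perm_lift. Qed.

Lemma sum_lift_perm (f : 'I_n.+1 -> 'I_n.+1 -> bool) (g : 'I_n -> 'I_n -> bool) :
    f j v = false -> (forall b, f (lift j b) (lift v (y b)) = g b (y b)) ->
  \sum_(b < n.+1) f b (x b) = \sum_(b < n) g b (y b).
Proof.
move=> f0 fg; rewrite (bigD1_ord j) //= lift_perm_id f0.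
by apply: eq_bigr => b _; rewrite lift_perm_lift fg.
Qed.

Lemma nw_lift a : v <= y a -> nw x (lift j a) = nw y a.
Proof.
move=> le_v; rewrite /nw lift_perm_lift.
apply: (sum_lift_perm (f := fun b c => (b < lift j a) && (lift v (y a) < c))
                      (g := fun b c => (b < a) && (y a < c))) => [|b] /=;
  rewrite /bump; lia.
Qed.

Lemma ucros_lift a : j <= y a -> v <= y a -> ucros x (lift j a) = ucros y a.
Proof.
move=> le_j le_v; rewrite /ucros lift_perm_lift.
apply: (sum_lift_perm
  (f := fun b c => [&& lift j a < b, b <= lift v (y a) & lift v (y a) < c])
  (g := fun b c => [&& a < b, b <= y a & y a < c])) => [|b] /=;
  rewrite /bump; lia.
Qed.

Variable i : 'I_n.
Hypotheses (le_ji : j <= i) (le_vi : v <= i).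

Lemma se_lift : se x (lift j i) = se y i.
Proof.
rewrite /se lift_perm_lift.
apply: (sum_lift_perm (f := fun b c => (lift j i < b) && (c < lift v (y i)))
                      (g := fun b c => (i < b) && (c < y i))) => [|b] /=;
  rewrite /bump; lia.
Qed.

Lemma lcros_lift : lcros x (lift j i) = lcros y i.
Proof.
rewrite /lcros lift_perm_lift; apply: (sum_lift_perm
  (f := fun b c => [&& lift j i < b, lift v (y i) < c & c < lift j i])
  (g := fun b c => [&& i < b, y i < c & c < i])) => [|b] /=;
  rewrite /bump; lia.
Qed.

Lemma height_lift : height x (lift j i) = height y i.
Proof.
apply: (sum_lift_perm (f := fun b c => (b < lift j i) && (lift j i <= c))
                      (g := fun b c => (b < i) && (i <= c))) => [|b] /=;
  rewrite /bump; lia.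
Qed.

Let ltE (h : 'I_n.+1) (a : 'I_n) : h <= i ->
  (lift h a < lift j i = (a < i)) * (lift j i < lift h a = (i < a)).
Proof. by move=> le_h; split; rewrite /= /bump; lia. Qed.

(** Both embeddings send [i] to [i + 1], which keeps the diagonal aligned
beyond the deleted point. *)
Lemma lift_swap : lift j i = lift v i.
Proof. by apply: val_inj; rewrite /= /bump le_ji le_vi. Qed.

Let xE : x (lift j i) = lift v (y i).
Proof. exact: lift_perm_lift. Qed.

Let xVE : (x^-1)%g (lift j i) = lift j ((y^-1)%g i).
Proof. by rewrite lift_swap lift_perm_inv_lift. Qed.

Let fixE : (x (lift j i) == lift j i) = (y i == i).
Proof. by rewrite xE lift_swap (inj_eq lift_inj). Qed.

(** The deleted point has both coordinates at most [i], so in the larger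
permutation it lies strictly below and to the left of the index [i + 1] that
corresponds to [i] and takes part in none of the counts there, while all
other comparisons are preserved by the order embeddings [lift j] and [lift v]. *)
Lemma statistics_lift :
  [/\ is_cval x (lift j i) = is_cval y i, is_cda x (lift j i) = is_cda y i,
      is_cdd x (lift j i) = is_cdd y i & (x (lift j i) == lift j i) = (y i == i)] /\
  [/\ nest_at x (lift j i) = nest_at y i, cros_at x (lift j i) = cros_at y i,
      lmax_at x (lift j i) = lmax_at y i & rmin_at x (lift j i) = rmin_at y i].
Proof.
have nwV : nw x (lift j ((y^-1)%g i)) = nw y ((y^-1)%g i).
  by rewrite nw_lift ?permKV.
have ucV : ucros x (lift j ((y^-1)%g i)) = ucros y ((y^-1)%g i).
  by rewrite ucros_lift ?permKV.
have nwF : y i == i -> nw x (lift j i) = nw y i.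
  by move/eqP=> yi; rewrite nw_lift ?yi.
split; split => //.
- by rewrite /is_cval xVE xE !ltE.
- by rewrite /is_cda xVE xE !ltE.
- by rewrite /is_cdd xVE xE !ltE.
- rewrite /nest_at fixE xVE xE !ltE // nwV se_lift.
  by have [/eqP/nwF->|] := y i =P i.
- by rewrite /cros_at xVE xE !ltE // ucV lcros_lift.
- rewrite /lmax_at fixE xVE !ltE // nwV.
  by have [/eqP/nwF->|] := y i =P i.
- rewrite /rmin_at fixE xE !ltE // se_lift.
  by have [/eqP/nwF->|] := y i =P i.
Qed.

End Deletion.

Section LiftPerm.
Variable n : nat.

Lemma lift_perm_inj (j v : 'I_n.+1) : injective (@lift_perm n j v).
Proof.
move=> y z eq_yz; apply/permP => b; apply: (@lift_inj _ v).
by rewrite -!(lift_perm_lift j) eq_yz.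
Qed.

Lemma lift_perm_exists (j v : 'I_n.+1) (x : 'S_n.+1) :
  x j = v -> exists y, x = lift_perm j v y.
Proof.
move=> xj; pose h b := odflt b (unlift v (x (lift j b))).
have hE b : lift v (h b) = x (lift j b).
  rewrite /h; case: unliftP => [c -> //|]; rewrite -xj.
  by move/perm_inj/eqP; rewrite eq_sym (negPf (neq_lift _ _)).
have h_inj : injective h.
  by move=> b c /(congr1 (lift v)); rewrite !hE => /perm_inj/lift_inj.
exists (perm h_inj); apply/permP => a.
by case: (unliftP j a) => [b|] ->; rewrite ?lift_perm_id // lift_perm_lift permE.
Qed.

(** A permutation sending [j] to [v] is the same thing as a permutation of one
point less, by deletion of the point [(j, v)]. *)
Lemma sum_perm_with_value (R : nmodType) (j v : 'I_n.+1) (P : pred 'S_n.+1)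
    (F : 'S_n.+1 -> R) :
  \sum_(x | P x && (x j == v)) F x
    = \sum_(y | P (lift_perm j v y)) F (lift_perm j v y).
Proof.
pose g (x : 'S_n.+1) : 'S_n := odflt 1%g [pick y | x == lift_perm j v y].
have gK y : g (lift_perm j v y) = y.
  rewrite /g; case: pickP => [z /eqP/lift_perm_inj //|/(_ y)].
  by rewrite eqxx.
rewrite (reindex_onto (lift_perm j v) g) => [|x /andP[_ /eqP/lift_perm_exists[y ->]]].
  by apply: eq_bigl => y; rewrite gK lift_perm_id !eqxx !andbT.
by rewrite gK.
Qed.
End LiftPerm.

(** * Contributions of the first index that is not matched *)

Section FirstUnmatched.
Local Open Scope nat_scope.
Variables (n : nat) (x : 'S_n) (i : 'I_n).
Hypothesis blk : forall b : 'I_n, b < i -> i <= x b.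

Let le_in : i <= n. Proof. exact: ltnW. Qed.

(** Under [blk] all positions below [i] are open, and so are all values below
[i]; hence an open position [a] has exactly [a] open positions before it, and
similarly for values. *)
Lemma height_block : height x i = i.
Proof.
rewrite -[RHS](sum_ltn_ord le_in); apply: eq_bigr => b _.
by have := @blk b; case: ltnP => // _ ->.
Qed.

Lemma nw_block_fixed : x i = i -> nw x i = i.
Proof.
move=> xi; rewrite -[RHS](sum_ltn_ord le_in); apply: eq_bigr => b _.
by have := @blk b; have := @perm_val_inj _ x b i; rewrite xi; lia.
Qed.

Lemma nw_block a : x a = i -> a < i -> nw x a = a.
Proof.
move=> xa lt_ai; rewrite -[RHS](@sum_ltn_ord n a); last exact: ltnW.
apply: eq_bigr => b _.
by have := @blk b; have := @perm_val_inj _ x b a; rewrite xa; lia.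
Qed.

(** The last term is the crossing with the arc that starts at [i] itself when
[i] is a cycle double ascent. *)
Lemma ucros_block a : x a = i -> a < i -> ucros x a = i.-1 - a + (i < x i).
Proof.
move=> xa lt_ai.
have: \sum_(b < n) (a < b < i) + a.+1 = i.
  rewrite -[RHS](sum_ltn_ord le_in) -{2}(@sum_ltn_ord n a.+1) //.
  by rewrite -big_split; apply: eq_bigr => b _ /=; lia.
have: \sum_(b < n) (b == i) * (i < x i) = (i < x i).
  rewrite (bigD1 i) //= eqxx big1 ?addn0 ?mul1n // => b /negPf->.
  by rewrite mul0n.
suff -> : ucros x a = \sum_(b < n) (a < b < i) + \sum_(b < n) (b == i) * (i < x i).
  by move=> -> ; move: (\sum_(b < n) _) => S; lia.
rewrite -big_split; apply: eq_bigr => b _ /=; rewrite xa.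
have [->|] := eqVneq b i; first by rewrite mul1n; lia.
rewrite -(inj_eq val_inj) /= => ne_bi.
by have := @blk b; have := @perm_val_inj _ x b a; rewrite xa; lia.
Qed.

Lemma se_block : x i < i -> se x i = x i.
Proof.
move=> lt_xi; rewrite -[RHS](@sum_ltn_perm n x (x i)); last exact: ltnW.
apply: eq_bigr => b _.
by have := @blk b; have := @perm_val_inj _ x b i; have [->|] := eqVneq b i;
  rewrite -?(inj_eq val_inj) /=; lia.
Qed.

Lemma lcros_block : x i < i -> lcros x i = i.-1 - x i.
Proof.
move=> lt_xi.
have: \sum_(b < n) (x i < x b < i) + (x i).+1 = i.
  rewrite -[RHS](@sum_ltn_perm n x i) // -{2}(@sum_ltn_perm n x (x i).+1) //.
  by rewrite -big_split; apply: eq_bigr => b _ /=; lia.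
suff -> : lcros x i = \sum_(b < n) (x i < x b < i).
  by move: (\sum_(b < n) _) => S; lia.
apply: eq_bigr => b _.
by have := @blk b; have [->|] := eqVneq b i; rewrite -?(inj_eq val_inj) /=; lia.
Qed.
End FirstUnmatched.

(** * Weights and their recursion *)

Lemma ltn_asymF m n : (m < n)%N -> (n < m)%N = false.
Proof. by move=> lt_mn; rewrite ltnNge ltnW. Qed.

Lemma permV_eq n (x : 'S_n) (i j : 'I_n) : ((x^-1)%g i == j) = (x j == i).
Proof. by rewrite -(inj_eq (@perm_inj _ x)) permKV eq_sym. Qed.

Section Weights.
Variables (R : comNzRingType) (u1 u2 u3 u4 t s h alpha beta p q : R).

Definition weight n (x : 'S_n) (i : 'I_n) : R :=
  (u1 * u2) ^+ is_cval x i * u3 ^+ is_cda x i * u4 ^+ is_cdd x i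
  * t ^+ (x i == i) * (s * h) ^+ height x i * (q * s) ^+ nest_at x i
  * p ^+ cros_at x i * alpha ^+ lmax_at x i * beta ^+ rmin_at x i.

(** The factor contributed by the indices that have not been read. *)
Definition tail_weight n (x : 'S_n) k : R := \prod_(i < n | (k <= i)%N) weight x i.

(** The states of the scan: positions and values below [k] are the open ones,
and open ones are never matched with each other. *)
Definition unmatched_below n (x : 'S_n) k : bool :=
  [forall b : 'I_n, (b < k)%N ==> (k <= x b)%N].

(** The weighted count of the ways to finish the scan from a state with [k]
open positions and [n - k] indices left to read. *)
Definition open_sum n k : R := \sum_(x : 'S_n | unmatched_below x k) tail_weight x k.

Lemma unmatched_belowP n (x : 'S_n) k :
  reflect (forall b : 'I_n, b < k -> k <= x b)%N (unmatched_below x k).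
Proof. by apply: (iffP forallP) => fr b; apply/implyP/fr. Qed.

(** No point of the graph has both coordinates below [k], a condition that is
symmetric in positions and values. *)
Lemma unmatched_belowV n (x : 'S_n) k : unmatched_below (x^-1)%g k = unmatched_below x k.
Proof.
by apply/unmatched_belowP/unmatched_belowP => fr b lt_bk; rewrite leqNgt;
  apply/negP => /fr; rewrite ?permK ?permKV leqNgt lt_bk.
Qed.

Lemma expr_sumn n (a : R) (f : 'I_n -> nat) :
  a ^+ (\sum_i f i)%N = \prod_i a ^+ f i.
Proof. exact: (big_morph _ (exprD a) (expr0 a)). Qed.

(** The scan starts with nothing open, so every permutation occurs. *)
Lemma Cpoly_open_sum n :
  Cpoly n u1 u2 u3 u4 t s h alpha beta p q = open_sum n 0.
Proof.
apply: eq_big => [x|x _]; first by apply/esym/unmatched_belowP.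
rewrite inv_depth_nest exprD.
have regroup (w a b c d e f g : R) :
    w * (a * b) * c * d * e * f * g = w * (a * c) * (g * b) * f * d * e by ring.
rewrite regroup.
rewrite -!exprMn depth_height nest_sum cros_sum lmax_sum rmin_sum.
rewrite /cval /cda /cdd /fixp !card_set_sum !expr_sumn -!big_split.
by apply: eq_bigr => i _.
Qed.

Section Step.
Variables (n k : nat) (x : 'S_n.+1) (i : 'I_n.+1).
Hypothesis ik : i = k :> nat.

Lemma tail_weightS : tail_weight x k = weight x i * tail_weight x k.+1.
Proof.
rewrite /tail_weight (bigD1 i) ?ik //=; congr (_ * _).
by apply: eq_bigl => a; rewrite -(inj_eq val_inj) /=; lia.
Qed.
End Step.

Lemma tail_weight_lift n (j v : 'I_n.+1) (y : 'S_n) k : (j <= k)%N -> (v <= k)%N ->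
  (k <= n)%N -> tail_weight (lift_perm j v y) k.+1 = tail_weight y k.
Proof.
move=> le_j le_v le_kn; pose i0 : 'I_n.+1 := Ordinal (le_kn : (k < n.+1)%N).
rewrite /tail_weight big_mkcond (bigD1_ord i0) //= ltnn mul1r [RHS]big_mkcond.
apply: eq_bigr => a _ /=; rewrite /bump.
have [le_ka|lt_ak] /= := leqP k a; last by rewrite ifF //; lia.
have -> : lift i0 a = lift j a.
  by apply: val_inj; rewrite /= /bump le_ka (leq_trans le_j le_ka).
have [[E1 E2 E3 E4] [E5 E6 E7 E8]] :=
  statistics_lift y (leq_trans le_j le_ka) (leq_trans le_v le_ka).
rewrite /weight E1 E2 E3 E4 E5 E6 E7 E8 height_lift ?(leq_trans le_j le_ka) //.
  by rewrite ifT //; lia.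
by rewrite (leq_trans le_v).
Qed.

Section LocalWeight.
Variables (n : nat) (x : 'S_n) (i : 'I_n).
Hypothesis fr : unmatched_below x i.
Let blk := unmatched_belowP _ _ fr.

Lemma weight_fixed : x i = i ->
  weight x i = (s * h) ^+ i * (t * (q * s) ^+ i * (alpha * beta) ^+ (i == 0 :> nat)).
Proof.
move=> xi; have xVi : (x^-1)%g i = i by rewrite -{1}xi permK.
rewrite /weight /is_cval /is_cda /is_cdd /nest_at /cros_at /lmax_at /rmin_at.
rewrite height_block // xi xVi eqxx ltnn /= nw_block_fixed //.
rewrite !(mul0n, mul1n, add0n, addn0, expr0, expr1, mul1r, mulr1).
by rewrite [(alpha * beta) ^+ _]exprMn; ring.
Qed.

Lemma weight_valley : (i < x i)%N -> (i < (x^-1)%g i)%N ->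
  weight x i = u1 * u2 * (s * h) ^+ i.
Proof.
move=> lt_x lt_xV.
rewrite /weight /is_cval /is_cda /is_cdd /nest_at /cros_at /lmax_at /rmin_at.
have -> : (x i == i) = false by apply/eqP => xi; rewrite xi ltnn in lt_x.
rewrite height_block // lt_x lt_xV (ltn_asymF lt_x) (ltn_asymF lt_xV) /=.
by rewrite !(mul0n, mul1n, add0n, addn0, expr0, expr1, mul1r, mulr1).
Qed.

Lemma weight_cda a : x a = i -> (a < i)%N -> (i < x i)%N ->
  weight x i = (s * h) ^+ i * (u3 * p)
     * (p ^+ (i.-1 - a) * (q * s) ^+ a * alpha ^+ (a == 0 :> nat)).
Proof.
move=> xa lt_ai lt_x; have xVi : (x^-1)%g i = a by rewrite -xa permK.
rewrite /weight /is_cval /is_cda /is_cdd /nest_at /cros_at /lmax_at /rmin_at.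
have -> : (x i == i) = false by apply/eqP => xi; rewrite xi ltnn in lt_x.
rewrite height_block // xVi lt_x lt_ai (ltn_asymF lt_x) (ltn_asymF lt_ai) /=.
rewrite (nw_block blk xa lt_ai) (ucros_block blk xa lt_ai) lt_x.
rewrite !(mul0n, mul1n, add0n, addn0, expr0, expr1, mul1r, mulr1) exprD.
by ring.
Qed.

Lemma weight_cdd : (x i < i)%N -> (i < (x^-1)%g i)%N ->
  weight x i = (s * h) ^+ i * u4
     * (p ^+ (i.-1 - x i) * (q * s) ^+ x i * beta ^+ (x i == 0 :> nat)).
Proof.
move=> lt_x lt_xV.
rewrite /weight /is_cval /is_cda /is_cdd /nest_at /cros_at /lmax_at /rmin_at.
have -> : (x i == i) = false by apply/eqP => xi; rewrite xi ltnn in lt_x.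
rewrite height_block // lt_x lt_xV (ltn_asymF lt_x) (ltn_asymF lt_xV) /=.
rewrite se_block // lcros_block //.
rewrite !(mul0n, mul1n, add0n, addn0, expr0, expr1, mul1r, mulr1).
by ring.
Qed.

Lemma weight_peak a : x a = i -> (a < i)%N -> (x i < i)%N ->
  weight x i = (s * h) ^+ i
     * (p ^+ (i.-1 - a) * (q * s) ^+ a * alpha ^+ (a == 0 :> nat))
     * (p ^+ (i.-1 - x i) * (q * s) ^+ x i * beta ^+ (x i == 0 :> nat)).
Proof.
move=> xa lt_ai lt_x; have xVi : (x^-1)%g i = a by rewrite -xa permK.
rewrite /weight /is_cval /is_cda /is_cdd /nest_at /cros_at /lmax_at /rmin_at.
have -> : (x i == i) = false by apply/eqP => xi; rewrite xi ltnn in lt_x.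
rewrite height_block // xVi lt_x lt_ai (ltn_asymF lt_x) (ltn_asymF lt_ai) /=.
rewrite (nw_block blk xa lt_ai) (ucros_block blk xa lt_ai) se_block // lcros_block //.
rewrite (ltn_asymF lt_x).
rewrite !(mul0n, mul1n, add0n, addn0, expr0, expr1, mul1r, mulr1) !exprD.
by ring.
Qed.
End LocalWeight.

(** The generating function of the choice of an open position (or value) among
[k], the [j]-th one having [j] open ones before it. *)
Definition closing_sum (a : R) k : R :=
  \sum_(j < k) p ^+ (k.-1 - j) * (q * s) ^+ j * a ^+ (j == 0 :> nat).

Lemma closing_sumE a k : closing_sum a k.+1 = pqbracket k.+1 a 1 p (q * s).
Proof.
rewrite /closing_sum /pqbracket /pqint !big_ord_recl /= subrr mul0r addr0 subn0.
by under eq_bigr do rewrite mulr1; ring.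
Qed.

Lemma closing_sum_widen n k a : (k <= n)%N ->
  \sum_(j < n | (j < k)%N) p ^+ (k.-1 - j) * (q * s) ^+ j * a ^+ (j == 0 :> nat)
    = closing_sum a k.
Proof.
by move=> le_kn; rewrite -(big_ord_widen _ (fun j =>
  p ^+ (k.-1 - j) * (q * s) ^+ j * a ^+ (j == 0)%N)).
Qed.

Section Cases.
Variables (n k : nat) (le_kn : (k <= n)%N).
Let i : 'I_n.+1 := Ordinal (le_kn : (k < n.+1)%N).

Lemma sum_fixed :
  \sum_(x : 'S_n.+1 | unmatched_below x k && (x i == i)) tail_weight x k
    = (s * h) ^+ k * (t * (q * s) ^+ k * (alpha * beta) ^+ (k == 0)) * open_sum n k.
Proof.
rewrite sum_perm_with_value mulr_sumr; apply: eq_big => [y|y fr].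
  apply/unmatched_belowP/unmatched_belowP => fr b lt_bk.
    have := fr (lift i b); rewrite lift_perm_lift /= /bump; lia.
  case: (unliftP i b) lt_bk => [b'|] -> ; last by rewrite ltnn.
  by move=> lt_bk; have := fr b'; rewrite lift_perm_lift /= /bump in lt_bk *; lia.
rewrite (@tail_weightS _ _ _ i) // tail_weight_lift //.
by rewrite (@weight_fixed _ _ i fr) ?lift_perm_id.
Qed.

(** Nothing is deleted: [k] merely joins the open positions and values. *)
Lemma sum_valley :
  \sum_(x : 'S_n.+1 | unmatched_below x k && ((i < x i) && (i < (x^-1)%g i))%N)
     tail_weight x k = u1 * u2 * (s * h) ^+ k * open_sum n.+1 k.+1.
Proof.
rewrite mulr_sumr; apply: eq_big => [x|x /and3P[fr lt_x lt_xV]].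
  apply/idP/unmatched_belowP => [/and3P[/unmatched_belowP fr lt_x lt_xV] b|fr].
    rewrite ltnS leq_eqVlt => /predU1P[eq_bk|lt_bk].
      by rewrite (_ : b = i) //; apply: val_inj.
    have := fr b lt_bk; rewrite leq_eqVlt => /predU1P[eq_xb|//].
    have xb : x b = i by apply: val_inj.
    by move: lt_xV; rewrite -xb permK xb /= ltnNge (ltnW lt_bk).
  rewrite (fr i) //= andbC; apply/andP; split; last first.
    by apply/unmatched_belowP => b lt_bk; rewrite ltnW // fr // ltnW.
  rewrite ltnNge; apply/negP => le_xV; have := fr ((x^-1)%g i) le_xV.
  by rewrite permKV ltnn.
by rewrite (@tail_weightS _ _ _ i) // (@weight_valley _ _ i fr).
Qed.

(** After the deletion of the point [(j, k)], position [k] becomes position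
[k - 1] and is the newest open position, which is why it must not carry an open
value. *)
Lemma unmatched_below_close (j : 'I_n.+1) (y : 'S_n) : (j < k)%N ->
  unmatched_below (lift_perm j i y) k && (i < lift_perm j i y i)%N = unmatched_below y k.
Proof.
move=> lt_jk; have xE b : lift_perm j i y (lift j b) = lift i (y b).
  exact: lift_perm_lift.
apply/andP/unmatched_belowP => [[/unmatched_belowP fr lt_x] b lt_bk|fr].
  have [eq_bk|ne_bk] := eqVneq (lift j b) i.
    have : (i < lift_perm j i y (lift j b))%N by rewrite eq_bk.
    by rewrite xE /= /bump; lia.
  have := fr (lift j b); rewrite xE.
  by rewrite -(inj_eq val_inj) /= /bump in ne_bk *; lia.
split; last first.
  case: (unliftP j i) => [b ib|ij]; last by move: lt_jk; rewrite -ij /= ltnn.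
  rewrite [X in fun_of_perm _ X]ib xE.
  by have := fr b; have := congr1 val ib; rewrite /= /bump; lia.
apply/unmatched_belowP => a; case: (unliftP j a) => [b ->|-> _]; last first.
  by rewrite lift_perm_id.
by have := fr b; rewrite xE /= /bump; lia.
Qed.

Lemma sum_cda :
  \sum_(x : 'S_n.+1 | unmatched_below x k && ((i < x i) && ((x^-1)%g i < i))%N)
     tail_weight x k = (s * h) ^+ k * (u3 * p) * closing_sum alpha k * open_sum n k.
Proof.
rewrite (partition_big (fun x : 'S_n.+1 => (x^-1)%g i) (fun j => j < k)%N) /=;
  last by move=> x /and3P[].
rewrite -(closing_sum_widen _ (leqW le_kn)) [X in X * _]mulr_sumr mulr_suml.
apply: eq_bigr => j lt_jk.
under eq_bigl => x do rewrite permV_eq.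
rewrite sum_perm_with_value mulr_sumr; apply: eq_big => [y|y].
  by rewrite lift_permV lift_perm_id /= lt_jk andbT unmatched_below_close.
case/and3P=> fr lt_x lt_xV.
rewrite (@tail_weightS _ _ _ i) // tail_weight_lift //.
  by rewrite (@weight_cda _ _ i fr j) ?lift_perm_id.
exact: ltnW.
Qed.

Lemma sum_cdd :
  \sum_(x : 'S_n.+1 | unmatched_below x k && ((x i < i) && (i < (x^-1)%g i))%N)
     tail_weight x k = (s * h) ^+ k * u4 * closing_sum beta k * open_sum n k.
Proof.
rewrite (partition_big (fun x : 'S_n.+1 => x i) (fun v => v < k)%N) /=;
  last by move=> x /and3P[].
rewrite -(closing_sum_widen _ (leqW le_kn)) [X in X * _]mulr_sumr mulr_suml.
apply: eq_bigr => v lt_vk.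
rewrite sum_perm_with_value mulr_sumr; apply: eq_big => [y|y].
  rewrite lift_perm_id /= lt_vk -unmatched_belowV lift_permV unmatched_below_close //.
  by rewrite unmatched_belowV.
case/and3P=> fr lt_x lt_xV.
rewrite (@tail_weightS _ _ _ i) // tail_weight_lift //.
  by rewrite (@weight_cdd _ _ i fr) ?lift_perm_id.
exact: ltnW.
Qed.

(** Kept apart from the other moves because a peak deletes two points, which
requires [k > 0]. *)
Definition peak_sum : R :=
  \sum_(x : 'S_n.+1 | unmatched_below x k && ((x i < i) && ((x^-1)%g i < i))%N)
     tail_weight x k.

Lemma open_sum_cases : open_sum n.+1 k =
  ((s * h) ^+ k * (t * (q * s) ^+ k * (alpha * beta) ^+ (k == 0))
   + (s * h) ^+ k * (u3 * p) * closing_sum alpha k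
   + (s * h) ^+ k * u4 * closing_sum beta k) * open_sum n k
  + u1 * u2 * (s * h) ^+ k * open_sum n.+1 k.+1 + peak_sum.
Proof.
rewrite !mulrDl -sum_fixed -sum_cda -sum_cdd -sum_valley /peak_sum /open_sum.
rewrite [X in X = _]big_mkcond [X in _ = X + _ + _ + _ + _]big_mkcond.
rewrite [X in _ = _ + X + _ + _ + _]big_mkcond [X in _ = _ + _ + X + _ + _]big_mkcond.
rewrite [X in _ = _ + _ + _ + X + _]big_mkcond [X in _ = _ + X]big_mkcond.
rewrite -!big_split; apply: eq_bigr => x _ /=.
have xVi : ((x^-1)%g i == i) = (x i == i) by apply: permV_eq.
rewrite -!(inj_eq val_inj) /= in xVi *.
by case: unmatched_below; case: (ltngtP (x i) k) xVi; case: (ltngtP ((x^-1)%g i) k);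
  rewrite //= !(addr0, add0r).
Qed.
End Cases.

(** Two successive deletions: first the point at value [k + 1], which moves
position [k + 1] to [k], then the point at that position. *)
Lemma peak_sumE n k (le_kn : (k.+1 <= n.+1)%N) : peak_sum le_kn =
  (s * h) ^+ k.+1 * closing_sum alpha k.+1 * closing_sum beta k.+1 * open_sum n k.
Proof.
pose i : 'I_n.+2 := Ordinal (le_kn : (k.+1 < n.+2)%N).
(* The index of position [k + 1] once the first point is deleted. *)
pose i' : 'I_n.+1 := Ordinal (le_kn : (k < n.+1)%N).
have iE (j : 'I_n.+2) : (j < k.+1)%N -> i = lift j i'.
  by move=> lt_jk; apply: val_inj; rewrite /= /bump; lia.
have xiE (j : 'I_n.+2) y : (j < k.+1)%N -> lift_perm j i y i = lift i (y i').
  by move=> /iE ij; rewrite [X in fun_of_perm _ X]ij lift_perm_lift.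
rewrite /peak_sum (partition_big (fun x : 'S_n.+2 => (x^-1)%g i)
  (fun j => j < k.+1)%N) /=;
  last by move=> x /and3P[].
rewrite -[closing_sum alpha _](closing_sum_widen _ (leqW le_kn)).
rewrite [X in X * _ * _]mulr_sumr !mulr_suml; apply: eq_bigr => j lt_jk.
under eq_bigl => x do rewrite permV_eq.
rewrite sum_perm_with_value.
rewrite (partition_big (fun y : 'S_n.+1 => y i') (fun v => v < k.+1)%N) /=; last first.
  by move=> y /and3P[_]; rewrite xiE //= /bump; lia.
rewrite -[closing_sum beta _](closing_sum_widen _ le_kn).
rewrite [X in X * _]mulr_sumr mulr_suml; apply: eq_bigr => v lt_vk.
rewrite sum_perm_with_value mulr_sumr; apply: eq_big => [z|z].
  rewrite lift_permV lift_perm_id xiE // lift_perm_id /= lt_jk andbT.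
  have -> : (bump k.+1 v < k.+1)%N by rewrite /bump; lia.
  rewrite andbT; apply/unmatched_belowP/unmatched_belowP => fr b lt_bk.
    have := fr (lift j (lift i' b)); rewrite !lift_perm_lift /= /bump; lia.
  case: (unliftP j b) lt_bk => [c|] -> ; last by rewrite lift_perm_id.
  case: (unliftP i' c) => [d|] ->; last by rewrite /= /bump; lia.
  by have := fr d; rewrite !lift_perm_lift /= /bump; lia.
case/and3P=> fr lt_x lt_xV; rewrite (@tail_weightS _ _ _ i) //.
rewrite tail_weight_lift // ?(ltnW lt_jk) // tail_weight_lift //.
rewrite (@weight_peak _ _ i fr j) ?lift_perm_id //.
rewrite xiE // lift_perm_id.
have -> : lift i v = v :> nat by rewrite /= /bump; lia.
by [].
Qed.

Lemma peak_sum0 n (le_kn : (0 <= n)%N) : peak_sum le_kn = 0.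
Proof. by apply: big1 => x /and3P[]. Qed.

(** When all indices are read, no permutation is compatible with a remaining
open position. *)
Lemma open_sum_base k : open_sum k k = (k == 0%N)%:R.
Proof.
case: k => [|k]; last first.
  rewrite /open_sum big_pred0 // => x; apply/negP => /unmatched_belowP/(_ ord0 erefl).
  by rewrite leqNgt ltn_ord.
have frP (x : 'S_0) : unmatched_below x 0 by apply/unmatched_belowP.
rewrite /open_sum (big_pred1 1%g) => [|x]; first by rewrite /tail_weight big_ord0.
by rewrite frP /=; apply/esym/eqP/permP => -[].
Qed.

Definition opening_coef k : R := u1 * u2 * (s * h) ^+ k.

Definition peak_coef k : R :=
  (s * h) ^+ k * closing_sum alpha k * closing_sum beta k.

Lemma lcoefS k :
  lcoef u1 u2 s h alpha beta p q k.+1 = opening_coef k * peak_coef k.+1.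
Proof.
rewrite /lcoef /opening_coef /peak_coef !closing_sumE.
have -> : (2 * k.+1 - 1 = k + k.+1)%N by lia.
by rewrite exprD; ring.
Qed.

Lemma open_sumS n k : open_sum (n.+1 + k) k =
  bcoef u3 u4 t s h alpha beta p q k * open_sum (n + k) k
  + opening_coef k * open_sum (n + k.+1) k.+1
  + (if k is j.+1 then peak_coef k * open_sum (n + j) j else 0).
Proof.
rewrite addSn (open_sum_cases (leq_addl n k)) addnS.
case: k => [|k]; rewrite ?peak_sum0 /bcoef.
  rewrite /closing_sum !big_ord0 !expr0 !expr1; congr (_ * _ + _ + _); ring.
rewrite !closing_sumE /opening_coef.
have -> : peak_sum (leq_addl n k.+1) = peak_coef k.+1 * open_sum (n + k) k.
  by move: (leq_addl _ _); rewrite addnS => le; rewrite peak_sumE.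
by congr (_ * _ + _ + _); rewrite [(q * s) ^+ _]exprMn mulr1; ring.
Qed.
End Weights.

Theorem theorem2p2 (R : comNzRingType)
    (u1 u2 u3 u4 t s h alpha beta p q : R) :
  Cgf u1 u2 u3 u4 t s h alpha beta p q
    =1 Jfrac (bcoef u3 u4 t s h alpha beta p q)
             (lcoef u1 u2 s h alpha beta p q).
Proof.
pose G k n := open_sum u1 u2 u3 u4 t s h alpha beta p q (n + k) k.
move=> n; transitivity (G 0%N n).
  by case: n => [|n]; rewrite /G ?addn0 ?open_sum_base //= Cpoly_open_sum.
apply: Jfrac_path (lcoefS _ _ _ _ _ _ _ _) _ _ n => [k|k m].
  exact: open_sum_base.
exact: open_sumS.
Qed.
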